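(* Let $n\ge 4$. For $\sigma\in S_n$ let $p=p(\sigma)$ be the number of fixed points and $t=t(\sigma)$ the number of 2-cycles of $\sigma$. Let $K$ be the set of all functions $g:S_n\to\mathbb{R}$ in $\operatorname{span}\{p-1,\ p^2-2,\ 1-2t\}$ such that $g(e)\ge g(\sigma)$ for all $\sigma\in S_n$, where $e$ is the identity permutation. Define functions on $S_n$ by $$r_1=\frac{-np+n+p^2-2}{n-2},\qquad r_2=1-2t,\qquad r_3=\frac{2np-3p-2n-p^2-2t+6}{n^2-5n+6},$$ $$r_4=\frac{p+2t-2}{n-2},\qquad r_{5o}=\frac{-2np+3p^2-3p+2tn+n-3}{n^2-2n-3}.$$ Then: (1) $r_1(e)=r_2(e)=r_3(e)=r_4(e)=r_{5o}(e)=1$. (2) If $n$ is even, then $r_1,r_2,r_3,r_4$ are the vertices (in consecutive order) of the planar quadrilateral $\operatorname{conv}\{r_1,r_2,r_3,r_4\}$, and this quadrilateral is a base of the cone $K$. (3) If $n$ is odd, then $r_1,r_2,r_3,r_4,r_{5o}$ are the vertices (in consecutive order) of the planar pentagon $\operatorname{conv}\{r_1,r_2,r_3,r_4,r_{5o}\}$, and this pentagon is a base of the cone $K$.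
   Context: $S_n$ is the group of permutations of $\{1,\dots,n\}$; $p(\sigma)=|\{i:\sigma(i)=i\}|$ and $t(\sigma)=|\{i<j:\sigma(i)=j,\ \sigma(j)=i\}|$. The space $\operatorname{span}\{p-1,p^2-2,1-2t\}$ is identified with $\mathbb{R}^3$, in which $K$ is a convex polyhedral cone. The base of $K$ meant here is $B=K\cap H$, where $H$ is the plane $\{g: g(e)=1\}$; being a base means that $B$ is a polygon such that every nonzero $g\in K$ can be uniquely represented as $g=\lambda h$ with $\lambda>0$ and $h\in B$. *)

(* Defs.v *)
From HB Require Import structures.
From mathcomp Require Import all_boot all_order all_algebra all_fingroup.
From mathcomp Require Import classical_sets reals.

Set Implicit Arguments.
Unset Strict Implicit.
Unset Printing Implicit Defensive.

Import Order.TTheory GRing.Theory Num.Theory.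

Local Open Scope classical_set_scope.
Local Open Scope ring_scope.

Section ConvexGeometry.
Variables (R : realType) (V : vectType R).

Definition conv_hull (s : seq V) : set V :=
  [set x | exists a : 'I_(size s) -> R,
     [/\ forall i, 0 <= a i, \sum_i a i = 1 & x = \sum_i a i *: s`_i]].

(* As usual for polytopes, f = 0 is allowed, so set0 and C are faces of C. *)
Definition is_face (C F : set V) : Prop :=
  exists (f : {linear V -> R^o}) (c : R),
    (forall x, C x -> f x <= c) /\ F = C `&` [set x | f x = c].

Definition is_vertex (C : set V) (v : V) : Prop := is_face C [set v].

Definition is_edge (C : set V) (v w : V) : Prop :=
  v != w /\ is_face C (conv_hull [:: v; w]).

Definition affine_dim (s : seq V) : nat :=
  \dim (span [seq x - head 0 s | x <- s]).

(* s lists the vertices of the polygon conv_hull s in consecutive (cyclic)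
   order; dimension 2 makes the polygon planar and nondegenerate. *)
Definition polygon_vertices (s : seq V) : Prop :=
  [/\ affine_dim s = 2%N,
      uniq s,
      forall v, is_vertex (conv_hull s) v <-> v \in s
    & forall i, (i < size s)%N ->
        is_edge (conv_hull s) s`_i s`_(i.+1 %% size s)].

Definition is_polygon (B : set V) : Prop :=
  exists s, polygon_vertices s /\ B = conv_hull s.

End ConvexGeometry.

Section PermutationFunctions.
Variables (R : realType) (n : nat).
Local Notation funS := {ffun 'S_n -> R^o}.

Definition nfix (s : 'S_n) : nat := #|[pred i | s i == i]|.

Definition ntwo (s : 'S_n) : nat :=
  #|[pred ij : 'I_n * 'I_n |
      [&& (ij.1 < ij.2)%N, s ij.1 == ij.2 & s ij.2 == ij.1]]|.

Local Notation N := (n%:R : R).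
Local Notation p s := ((nfix s)%:R : R).
Local Notation t s := ((ntwo s)%:R : R).

Definition spanV : {vspace funS} :=
  span [:: ([ffun s => p s - 1] : funS); [ffun s => p s ^+ 2 - 2] : funS;
           [ffun s => 1 - 2 * t s] : funS].

Definition coneK : set funS :=
  [set g | g \in spanV /\ forall s : 'S_n, g s <= g 1%g :> R].

Definition planeH : set funS := [set g | g 1%g = 1].

Definition is_base_of_K (B : set funS) : Prop :=
  [/\ B = coneK `&` planeH,
      is_polygon B
    & forall g, coneK g -> g != 0 ->
        exists! lh : R * funS, [/\ 0 < lh.1, B lh.2 & g = lh.1 *: lh.2]].

Definition r1 : funS :=
  [ffun s => (- N * p s + N + p s ^+ 2 - 2) / (N - 2)].

Definition r2 : funS := [ffun s => 1 - 2 * t s].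

Definition r3 : funS :=
  [ffun s => (2 * N * p s - 3 * p s - 2 * N - p s ^+ 2 - 2 * t s + 6)
             / (N ^+ 2 - 5 * N + 6)].

Definition r4 : funS := [ffun s => (p s + 2 * t s - 2) / (N - 2)].

Definition r5o : funS :=
  [ffun s => (- 2 * N * p s + 3 * p s ^+ 2 - 3 * p s + 2 * t s * N + N - 3)
             / (N ^+ 2 - 2 * N - 3)].

End PermutationFunctions.

(* Main.v *)
(* A permutation with [p] fixed points and [t] transpositions has
   [n = p + 2 t + m], where [m] counts the points on cycles of length at least 3,
   so [m = 0] or [m >= 3].  In the coordinates [g = A r1 + B r2 + C r4] one gets
   [(n - 2) (g e - g s) = A p (2 t + m) + 2 (n - 2) B t + C m]: every [r_i] lies
   in [K], and the facets of [K] come from evaluation at an [n]-cycle, a 3-cycle,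
   a transposition, the reversal [i -> n - 1 - i] and, for odd [n], a derangement
   with [t = (n - 3) / 2].  Evaluation at these permutations also supports the
   edges of the polygon.  Since [r3 = r4 + (r2 - r1) / (n - 3)], an element of [K]
   is a nonnegative combination of [r1, r2, r4] if [A, B >= 0], of [r2, r3, r4]
   if [A < 0], and of [r1, r4, r5o] if [B < 0], which forces [n] odd. *)
Require Import Defs.
From HB Require Import structures.
From mathcomp Require Import all_boot all_order all_algebra all_fingroup.
From mathcomp Require Import classical_sets reals.
From mathcomp Require Import zify ring lra.

Set Implicit Arguments.
Unset Strict Implicit.
Unset Printing Implicit Defensive.

Import Order.TTheory GRing.Theory Num.Theory.

(** * Points sorted by cycle length: 1, 2, or at least 3 *)

Section FixedPointsAndTranspositions.
Variable n : nat.
Implicit Types s : 'S_n.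

Definition nlong s : nat := #|[pred i | s (s i) != i]|.

(** Each 2-cycle is represented by its smaller point. *)
Lemma ntwo_ltE s : ntwo s = #|[pred i | (s (s i) == i) && (i < s i)%N]|.
Proof.
have pair_inj : injective (fun i : 'I_n => (i, s i)) by move=> i j [].
rewrite -(card_image pair_inj); apply: eq_card => -[i j]; rewrite !inE /=.
apply/and3P/fintype.imageP => [[ij /eqP si /eqP sj]|[k]].
  by exists i; rewrite ?inE ?si ?sj ?eqxx ?ij.
by rewrite inE => /andP[/eqP ssk k_lt] [-> ->]; rewrite ssk !eqxx.
Qed.

(** [s] maps the smaller point of a 2-cycle to the larger one; together with [ntwo_ltE] this
    accounts for all points on 2-cycles. *)
Lemma ntwo_gtE s : ntwo s = #|[pred i | (s (s i) == i) && (s i < i)%N]|.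
Proof.
rewrite ntwo_ltE -(card_image (@perm_inj _ s)); apply: eq_card => i.
rewrite !inE; apply/fintype.imageP/andP => [[k]|[/eqP ssi i_lt]].
  by rewrite inE => /andP[/eqP ssk k_lt] ->; rewrite ssk.
by exists (s i); rewrite ?inE ssi ?eqxx.
Qed.

Lemma nfix_ntwo_nlong s : (nfix s + (ntwo s).*2 + nlong s = n)%N.
Proof.
rewrite -addnn {1}ntwo_ltE ntwo_gtE.
(* Split the points by whether [s ^+ 2] fixes them, then those it fixes by whether [s] does, and the
   2-cycles by the order of [i] and [s i]. *)
rewrite -[RHS]card_ord -(cardC [pred i | s (s i) == i]); congr addn.
rewrite -(cardID [pred i | s i == i] [pred i | s (s i) == i]); congr addn.
  apply: eq_card => i; rewrite !inE andbC.
  by case: eqP => //= si; rewrite !si eqxx.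
rewrite -[RHS](cardID [pred i : 'I_n | (i < s i)%N]).
by congr addn; apply: eq_card => i; rewrite !inE -!val_eqE /=; lia.
Qed.

(* A point moved by [s ^+ 2] lies on a cycle of length at least 3. *)
Lemma nlong_gap s : nlong s = 0%N \/ (3 <= nlong s)%N.
Proof.
have [|i] := pickP [pred i | s (s i) != i]; last first.
  by left; apply: eq_card0.
rewrite /= => i ssi; right.
have si : s i != i by apply: contraNneq ssi => si; rewrite !si.
have ssi' : s (s i) != s i by rewrite (inj_eq perm_inj).
have us : uniq [:: i; s i; s (s i)].
  by rewrite /= !inE !negb_or eq_sym si eq_sym ssi eq_sym ssi'.
rewrite -[3%N](card_uniqP us); apply: subset_leq_card.
apply/fintype.subsetP => j; rewrite !inE => /or3P[] /eqP ->;
  by rewrite ?(inj_eq perm_inj) ?ssi.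
Qed.

End FixedPointsAndTranspositions.

Lemma nfix1 n : nfix (1%g : 'S_n) = n.
Proof.
by rewrite -[RHS]card_ord; apply: eq_card => i; rewrite !inE perm1 eqxx.
Qed.

Lemma ntwo1 n : ntwo (1%g : 'S_n) = 0%N.
Proof. by have := nfix_ntwo_nlong (1%g : 'S_n); rewrite nfix1; lia. Qed.

(** * Permutations that cut out the facets *)

Section Witnesses.
Variable n : nat.
Implicit Types s : 'S_n.

Lemma nfixC s : (nfix s + #|[pred i | s i != i]| = n)%N.
Proof. by rewrite -[RHS]card_ord -(cardC [pred i | s i == i]). Qed.

Lemma exists_long_cycle :
  (3 <= n)%N -> exists s, nfix s = 0%N /\ ntwo s = 0%N.
Proof.
move=> n_ge3.
have succ (i : nat) : (i < n)%N -> i.+1 %% n = if i.+1 == n then 0 else i.+1.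
  by case: eqP => [->|? ?]; [rewrite modnn | rewrite modn_small //; lia].
(* The shift [i -> i + 1] modulo [n]; since [n >= 3], its square has no fixed point either. *)
exists (perm (@ordS_inj n)); split.
  apply: eq_card0 => i; rewrite !inE permE -val_eqE /= succ //.
  by case: ifP; lia.
rewrite ntwo_ltE; apply: eq_card0 => i; rewrite !inE !permE -val_eqE /=.
have i_lt := ltn_ord i; rewrite !(succ i) //.
case: ifP => i1; rewrite succ; try lia.
by case: ifP; lia.
Qed.

Lemma exists_three_cycle :
  (3 <= n)%N -> exists s, (nfix s + 3)%N = n /\ ntwo s = 0%N.
Proof.
move=> n_ge3.
have [lt0 lt1] : (0 < n /\ 1 < n)%N by lia.
pose a := Ordinal lt0; pose b := Ordinal lt1; pose c := Ordinal n_ge3.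
pose s : 'S_n := (tperm a b * tperm b c)%g; exists s.
have fixE : (nfix s + 3)%N = n.
  rewrite -[RHS](nfixC s); congr addn.
  have us : uniq [:: a; b; c] by [].
  rewrite -[3%N](card_uniqP us); apply: eq_card => i; rewrite !inE permM.
  have [->|ia] := eqVneq i a; first by rewrite tpermL tpermL.
  have [->|ib] := eqVneq i b; first by rewrite tpermR tpermD.
  have [->|ic] := eqVneq i c; first by rewrite [tperm a b c]tpermD // tpermR.
  by rewrite [tperm a b i]tpermD 1?eq_sym // tpermD 1?eq_sym // eqxx.
(* Three points are moved, so [2 t + m = 3]; as [m] is 0 or at least 3, parity leaves [t = 0]. *)
split=> //; have := nfix_ntwo_nlong s; have := nlong_gap s; lia.
Qed.

Lemma exists_transposition :
  (2 <= n)%N -> exists s, (nfix s + 2)%N = n /\ ntwo s = 1%N.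
Proof.
move=> n_ge2; have lt0 : (0 < n)%N by lia.
pose a := Ordinal lt0; pose b := Ordinal n_ge2.
pose s : 'S_n := tperm a b; exists s.
have fixE : (nfix s + 2)%N = n.
  rewrite -[RHS](nfixC s); congr addn.
  have us : uniq [:: a; b] by [].
  rewrite -[2%N](card_uniqP us); apply: eq_card => i; rewrite !inE.
  by case: tpermP => [->|->|/eqP/negPf -> /eqP/negPf ->]; rewrite ?eqxx.
split=> //; have := nfix_ntwo_nlong s; have := nlong_gap s; lia.
Qed.

(** The reversal is an involution fixing at most the middle point, and parity decides whether it
    does. *)
Lemma exists_reversal :
  exists s, nfix s = odd n /\ (nfix s + (ntwo s).*2)%N = n.
Proof.
pose s : 'S_n := perm (@rev_ord_inj n); exists s.
have long0 : nlong s = 0%N.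
  by apply: eq_card0 => i; rewrite !inE !permE rev_ordK eqxx.
have fix_le : (nfix s <= 1)%N.
  apply/card_le1P => i; rewrite !inE permE -val_eqE /= => fi j.
  by rewrite !inE permE -!val_eqE /=; have := ltn_ord i; have := ltn_ord j; lia.
by have := nfix_ntwo_nlong s; lia.
Qed.

(** Following the reversal by the swap of [0] and the middle point [n./2] merges the pair
    [{0, n - 1}] and the fixed point into the 3-cycle [0 -> n - 1 -> n./2 -> 0]. *)
Lemma exists_odd_derangement :
  (3 <= n)%N -> odd n -> exists s, nfix s = 0%N /\ ((ntwo s).*2 + 3)%N = n.
Proof.
move=> n_ge3 n_odd.
have [lt0 ltm] : (0 < n /\ n./2 < n)%N by lia.
pose a := Ordinal lt0; pose m := Ordinal ltm.
pose s : 'S_n := (perm (@rev_ord_inj n) * tperm m a)%g; exists s.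
have sE i : s i = (if n - i.+1 == n./2 then 0 else
                   if n - i.+1 == 0 then n./2 else n - i.+1)%N :> nat.
  rewrite permM [perm _ i]permE;
  case: (tpermP m a (rev_ord i)) => [/(congr1 val)|/(congr1 val)|].
  - by move=> /= ->; rewrite eqxx.
  - by move=> /= ->; case: ifP => /=; lia.
  move=> /eqP/negPf + /eqP/negPf.
  by rewrite -!val_eqE /= => -> ->.
have fix0 : nfix s = 0%N.
  apply: eq_card0 => i; rewrite !inE -val_eqE /= sE; have := ltn_ord i.
  by do ?case: ifP; lia.
have long_le : (nlong s <= 3)%N.
  have lt_last : (n.-1 < n)%N by lia.
  apply: leq_trans (card_size [:: a; m; Ordinal lt_last]).
  apply: subset_leq_card; apply/fintype.subsetP => i; rewrite !inE -!val_eqE /= !sE.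
  by have := ltn_ord i; do ?case: ifP; lia.
(* Without fixed points [nlong s] has the parity of [n], so it is nonzero and hence exactly 3. *)
by split=> //; have := nfix_ntwo_nlong s; have := nlong_gap s; lia.
Qed.

End Witnesses.

Local Open Scope classical_set_scope.
Local Open Scope ring_scope.

(** * Faces of convex hulls and polygons *)

Section ConvexHulls.
Variables (R : realType) (V : vectType R).
Implicit Types (s : seq V) (v w x : V).

(** [conv_hull] wants one weight per position of [s], so the weights are collected at the first
    occurrence of each [v i]; the family may repeat points. *)
Lemma conv_hull_sum (I : finType) (a : I -> R) (v : I -> V) s :
    (forall i, 0 <= a i) -> \sum_i a i = 1 ->
    (forall i, a i != 0 -> v i \in s) ->
  conv_hull s (\sum_i a i *: v i).
Proof.
move=> a_ge0 a_sum1 vs.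
exists (fun j : 'I_(size s) =>
  \sum_(i | (v i \in s) && (index (v i) s == j)) a i).
have regroup (W : lmodType R) (F : I -> W) :
    \sum_(j < size s) \sum_(i | (v i \in s) && (index (v i) s == j)) a i *: F i
    = \sum_i a i *: F i.
  rewrite (exchange_big_dep xpredT) //=; apply: eq_bigr => i _.
  have [vi|vi] := boolP (v i \in s).
    rewrite (big_pred1 (Ordinal (etrans (index_mem (v i) s) vi))) // => j.
    by rewrite /= eq_sym.
  rewrite big_pred0 //; move: (vs i).
  case: eqVneq vi => [->|_ /negP vi /(_ isT)//].
  by rewrite scale0r.
split.
- by move=> j; apply: sumr_ge0.
(* The total weight is the case of [regroup] where every vector is the scalar 1. *)
- rewrite -[RHS]a_sum1.
  rewrite -[RHS](eq_bigr _ (fun i _ => mulr1 (a i))) -(regroup R^o (fun=> 1)).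
  by do 2![apply: eq_bigr => ? _]; rewrite /GRing.scale /= mulr1.
- rewrite -regroup; apply: eq_bigr => j _; rewrite scaler_suml.
  by apply: eq_bigr => i /andP[vi /eqP <-]; rewrite nth_index.
Qed.

Lemma mem_conv_hull s v : v \in s -> conv_hull s v.
Proof.
move=> vs.
have := @conv_hull_sum 'I_1 (fun=> 1) (fun=> v) s.
by rewrite !big_ord1 scale1r; apply.
Qed.

Lemma conv_hull1 v : conv_hull [:: v] = [set v].
Proof.
apply/seteqP; split => x /=; last by move=> ->; apply: mem_conv_hull; rewrite inE.
by case=> a [_]; rewrite !big_ord1 /= => -> ->; rewrite scale1r.
Qed.

(** The defect of the combination is the weighted sum of the nonnegative defects [c - f v] of its
    points, so it vanishes only if every term does. *)
Lemma linear_sum_le (f : {linear V -> R^o}) (c : R) s (a : 'I_(size s) -> R) :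
    (forall i, 0 <= a i) -> \sum_i a i = 1 ->
    (forall v, v \in s -> f v <= c :> R) ->
  (f (\sum_i a i *: s`_i) <= c :> R) /\
  (f (\sum_i a i *: s`_i) = c -> forall i, a i != 0 -> f s`_i = c).
Proof.
move=> a_ge0 a_sum1 fs.
have defect : c - f (\sum_i a i *: s`_i) = \sum_i a i * (c - f s`_i) :> R.
  rewrite linear_sum -[c in LHS]mulr1 -a_sum1 mulr_sumr -sumrB.
  by apply: eq_bigr => i _; rewrite linearZ mulrBr [c * _]mulrC.
have terms_ge0 i : 0 <= a i * (c - f s`_i).
  by rewrite mulr_ge0 // subr_ge0 fs // mem_nth.
split; first by rewrite -subr_ge0 defect sumr_ge0.
move=> fxc i ai0.
move: defect; rewrite fxc subrr => /esym/eqP.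
rewrite psumr_eq0 // => /allP/(_ i); rewrite mem_index_enum => /(_ isT).
by rewrite /= mulf_eq0 (negPf ai0) /= subr_eq0 => /eqP.
Qed.

(** By [linear_sum_le], a point attaining the bound uses only generators that attain it. *)
Lemma conv_hull_face (f : {linear V -> R^o}) (c : R) s s' :
    (forall v, v \in s -> f v <= c :> R) ->
    (forall v, (v \in s') = (v \in s) && (f v == c)) ->
  is_face (conv_hull s) (conv_hull s').
Proof.
move=> fs s'E; exists f, c; split.
  by move=> _ [a [a_ge0 a_sum1 ->]]; have [] := linear_sum_le a_ge0 a_sum1 fs.
apply/seteqP; split => x.
  case=> a [a_ge0 a_sum1 ->]; split.
    apply: conv_hull_sum => // i _.
    by have := mem_nth 0 (ltn_ord i); rewrite s'E => /andP[].
  rewrite /= linear_sum -[RHS]mul1r -a_sum1 mulr_suml.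
  apply: eq_bigr => i _; rewrite linearZ.
  by have := mem_nth 0 (ltn_ord i); rewrite s'E => /andP[_ /eqP ->].
case=> -[a [a_ge0 a_sum1 ->]] /= fx.
apply: conv_hull_sum => // i ai0.
rewrite s'E mem_nth //=; apply/eqP.
by have [_] := linear_sum_le a_ge0 a_sum1 fs; apply.
Qed.

(** A generator with nonzero weight in [v] also attains the bound, so it lies in the face, which is
    [v] alone. *)
Lemma vertex_conv_hull_mem s v : is_vertex (conv_hull s) v -> v \in s.
Proof.
case=> f [c [fs face]].
have fs' w : w \in s -> f w <= c :> R by move=> /mem_conv_hull /fs.
have [[a [a_ge0 a_sum1 vE]] fv] : (conv_hull s `&` [set x | f x = c]) v.
  by rewrite -face.
have [i ai0] : exists i, a i != 0.
  apply/existsP; apply: contraT; rewrite negb_exists => /forallP a0.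
  move: a_sum1; rewrite big1 => [/eqP|i _]; first by rewrite eq_sym oner_eq0.
  by apply/eqP; rewrite -[_ == _]negbK.
have [_] := linear_sum_le a_ge0 a_sum1 fs'; rewrite -vE => /(_ fv i ai0) fsi.
have : (conv_hull s `&` [set x | f x = c]) s`_i.
  by split=> //; apply: mem_conv_hull; rewrite mem_nth.
by rewrite -face => /= <-; rewrite mem_nth.
Qed.

(** Reduces a polygon to an incidence table: [f i] exposes the edge from vertex [i] to its cyclic
    successor, and the sum of the functionals of two adjacent edges exposes their common vertex. *)
Lemma polygon_vertices_supp s (f : nat -> {linear V -> R^o}) (c : R) :
    (2 < size s)%N -> affine_dim s = 2%N ->
    (forall i j, (i < size s)%N -> (j < size s)%N -> f i s`_j <= c :> R) ->
    (forall i j, (i < size s)%N -> (j < size s)%N ->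
       (f i s`_j == c) = (j == i) || (j == i.+1 %% size s)%N) ->
  polygon_vertices s.
Proof.
move=> s_gt2 dim2 f_le f_eq.
have succ i : (i < size s)%N ->
    (i.+1 %% size s = if i.+1 == size s then 0 else i.+1)%N.
  move=> i_lt; case: eqP => [->|ne]; first by rewrite modnn.
  by rewrite modn_small //; lia.
(* Positions of equal entries are equal or successors of each other, and the latter is impossible in
   a cycle of more than two. *)
have us : uniq s.
  apply/(uniqP 0) => i j; rewrite !inE => i_lt j_lt sij.
  have := f_eq i i i_lt i_lt; rewrite {1}sij f_eq // eqxx /= succ //.
  have := f_eq j j j_lt j_lt; rewrite -{1}sij f_eq // eqxx /= succ //.
  by do 2!case: ifP; lia.
split => //.
- move=> v; split; first exact: vertex_conv_hull_mem.
  case/(nthP 0) => j j_lt <-.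
  (* [i] is the cyclic predecessor of [j], so that the edges [i] and [j] share exactly vertex
     [j]. *)
  have [i i_lt ij] : exists2 i, (i < size s)%N & j = (i.+1 %% size s)%N.
    case: j j_lt => [|j] j_lt.
      by exists (size s).-1; rewrite (prednK j_lt) ?modnn.
    by exists j; [exact: ltnW | rewrite modn_small].
  rewrite /is_vertex -conv_hull1.
  apply: (@conv_hull_face (f i \+ f j) (c + c)).
    by move=> _ /(nthP 0)[k k_lt <-] /=; rewrite lerD // f_le.
  move=> w; rewrite inE; apply/eqP/andP => [->|[/(nthP 0)[k k_lt <-]]].
    split; first exact: mem_nth.
    rewrite /=; have /eqP -> : f j s`_j == c by rewrite f_eq // eqxx.
    have /eqP -> // : f i s`_j == c.
    by rewrite f_eq // -ij eqxx orbT.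
  move=> /eqP /= fk.
  have fik := f_le i k i_lt k_lt; have fjk := f_le j k j_lt k_lt.
  have : f i s`_k == c by apply/eqP; move: fk fik fjk; rewrite /=; lra.
  have : f j s`_k == c by apply/eqP; move: fk fik fjk; rewrite /=; lra.
  rewrite !f_eq // -ij succ // => jk ik; congr nth.
  by move: jk ik ij; rewrite succ // {fk fik fjk}; do 2!case: ifP; lia.
- move=> i i_lt.
  have i1_lt : (i.+1 %% size s < size s)%N by rewrite ltn_mod; lia.
  split; first by rewrite nth_uniq // succ //; case: ifP; lia.
  apply: (@conv_hull_face (f i) c).
    by move=> _ /(nthP 0)[k k_lt <-]; rewrite f_le.
  move=> w; rewrite !inE; apply/orP/andP.
    by case=> /eqP ->; rewrite mem_nth // f_eq // eqxx ?orbT.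
  case=> /(nthP 0)[k k_lt <-]; rewrite f_eq //.
  by case/orP => /eqP ->; rewrite eqxx; [left|right].
Qed.

End ConvexHulls.

(** * Evaluation at a permutation as a supporting functional *)

Section Evaluation.
Variables (R : realType) (n : nat) (s : 'S_n).

Definition eval_at (g : {ffun 'S_n -> R^o}) : R^o := g s.

Lemma eval_at_is_linear : linear eval_at.
Proof. by move=> a g h; rewrite /eval_at !ffunE. Qed.

HB.instance Definition _ :=
  GRing.isLinear.Build R {ffun 'S_n -> R^o} R^o *:%R eval_at eval_at_is_linear.

End Evaluation.

Section Cone.
Variables (R : realType) (n : nat).
Hypothesis n_ge4 : (4 <= n)%N.
Local Notation funS := {ffun 'S_n -> R^o}.
Local Notation N := (n%:R : R).
Local Notation p s := ((nfix s)%:R : R).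
Local Notation t s := ((ntwo s)%:R : R).
Local Notation m s := ((nlong s)%:R : R).
Local Notation r1 := (r1 R n).
Local Notation r2 := (r2 R n).
Local Notation r3 := (r3 R n).
Local Notation r4 := (r4 R n).
Local Notation r5 := (r5o R n).
Implicit Types s : 'S_n.

Lemma N_ge4 : 4 <= N. Proof. by rewrite ler_nat. Qed.
Lemma N2_neq0 : N - 2 != 0. Proof. by apply/eqP; move: N_ge4; lra. Qed.
Lemma N3_neq0 : N - 3 != 0. Proof. by apply/eqP; move: N_ge4; lra. Qed.
Lemma N1_neq0 : N + 1 != 0. Proof. by apply/eqP; move: N_ge4; lra. Qed.
Lemma N23_neq0 : N ^+ 2 - 5 * N + 6 != 0.
Proof.
by rewrite (_ : _ + 6 = (N - 2) * (N - 3)) ?mulf_neq0 ?N2_neq0 ?N3_neq0 //; ring.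
Qed.

Lemma N13_neq0 : N ^+ 2 - 2 * N - 3 != 0.
Proof.
by rewrite (_ : _ - 3 = (N + 1) * (N - 3)) ?mulf_neq0 ?N1_neq0 ?N3_neq0 //; ring.
Qed.

(** * The defects [1 - r_i s] and their zeros *)

Lemma N_cycles s : N = p s + 2 * t s + m s.
Proof.
by rewrite -{1}(nfix_ntwo_nlong s) !natrD -muln2 natrM mulrC.
Qed.

(** Writing each defect as a natural number over a positive denominator turns [r_i <= 1] and its
    equality case into arithmetic of cycle counts. *)
Lemma r1_gap s :
  1 - r1 s = (nfix s * ((ntwo s).*2 + nlong s))%:R / (N - 2) :> R.
Proof.
rewrite ffunE natrM natrD -muln2 natrM (_ : t s * 2 + m s = N - p s).
  by field; exact: N2_neq0.
by rewrite (N_cycles s); ring.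
Qed.

Lemma r2_gap s : 1 - r2 s = (ntwo s).*2%:R :> R.
Proof. by rewrite ffunE -muln2 natrM; ring. Qed.

Lemma r3_gap s :
  1 - r3 s = (((ntwo s).*2 + nlong s) * ((ntwo s).*2 + nlong s) + (ntwo s).*2
              - 3 * ((ntwo s).*2 + nlong s))%:R / (N ^+ 2 - 5 * N + 6) :> R.
Proof.
(* The subtraction does not truncate: [q = 2 t + m] is 0, or 2 with [t = 1], or at least 3, and
   [q (q - 3) + 2 t >= 0] in each case. *)
have le3 : (3 * ((ntwo s).*2 + nlong s)
    <= ((ntwo s).*2 + nlong s) * ((ntwo s).*2 + nlong s) + (ntwo s).*2)%N.
  have := nlong_gap s; move: (ntwo s) (nlong s) => [|[|k]] l; nia.
rewrite ffunE natrB // natrD !natrM natrD -muln2 natrM.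
rewrite (_ : t s * 2 + m s = N - p s); first by field; exact: N23_neq0.
by rewrite (N_cycles s); ring.
Qed.

Lemma r4_gap s : 1 - r4 s = (nlong s)%:R / (N - 2) :> R.
Proof.
rewrite ffunE (_ : m s = N - p s - 2 * t s); first by field; exact: N2_neq0.
by rewrite (N_cycles s); ring.
Qed.

(** Oddness enters when [p = 0]: the numerator is then [n (m - 3)], and parity excludes [m = 0]. For
    [p >= 1] the factor [3 p + n - 3] is at least [n]. *)
Lemma r5_gap s : odd n ->
  1 - r5 s = (((ntwo s).*2 + nlong s) * (3 * nfix s + n - 3) - (ntwo s).*2 * n)%:R
             / (N ^+ 2 - 2 * N - 3) :> R.
Proof.
move=> n_odd; have n_eq := nfix_ntwo_nlong s; have gap := nlong_gap s.
have le : ((ntwo s).*2 * n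
           <= ((ntwo s).*2 + nlong s) * (3 * nfix s + n - 3))%N.
  have [p0|p_gt0] := posnP (nfix s); last by nia.
  have l3 : (3 <= nlong s)%N by move: n_eq; rewrite p0; lia.
  by move: n_eq; rewrite p0; nia.
rewrite ffunE natrB // !natrM natrB; last by lia.
rewrite -!muln2 !(natrD, natrM).
rewrite (_ : t s * 2 + m s = N - p s); first by field; exact: N13_neq0.
by rewrite (N_cycles s); ring.
Qed.

Lemma le1_eq1_of_gap (x d : R) (k : nat) : 0 < d -> 1 - x = k%:R / d ->
  (x <= 1) * ((x == 1) = (k == 0%N)).
Proof.
move=> d_gt0 xE; split; first by rewrite -subr_ge0 xE divr_ge0 // ltW.
rewrite eq_sym -subr_eq0 xE mulf_eq0 invr_eq0 (gt_eqF d_gt0) orbF.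
by rewrite pnatr_eq0.
Qed.

Lemma N2_gt0 : 0 < N - 2. Proof. by move: N_ge4; lra. Qed.
Lemma N23_gt0 : 0 < N ^+ 2 - 5 * N + 6. Proof. by move: N_ge4; nra. Qed.
Lemma N13_gt0 : 0 < N ^+ 2 - 2 * N - 3. Proof. by move: N_ge4; nra. Qed.

Lemma r1_eq1 s : (r1 s == 1) = (nfix s == 0%N) || (nfix s == n).
Proof.
rewrite (le1_eq1_of_gap N2_gt0 (r1_gap s)) muln_eq0; congr orb.
by have := nfix_ntwo_nlong s; lia.
Qed.

Lemma r2_eq1 s : (r2 s == 1) = (ntwo s == 0%N).
Proof.
have := r2_gap s; rewrite -[_%:R]divr1 => /(le1_eq1_of_gap ltr01) ->.
by rewrite double_eq0.
Qed.

(** With [q = 2 t + m], the numerator [q (q - 3) + 2 t] is positive for [q > 3]; smaller values are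
    checked one by one. *)
Lemma r3_eq1 s :
  (r3 s == 1) = [|| nfix s == n, (nfix s).+2 == n | (nfix s).+3 == n].
Proof.
rewrite (le1_eq1_of_gap N23_gt0 (r3_gap s)).
have := nfix_ntwo_nlong s; have := nlong_gap s.
move: (nfix s) (ntwo s) (nlong s) => x y z gap n_eq.
have [q_le3|q_gt3] := leqP (y.*2 + z) 3; last by apply/idP/idP; nia.
by case: y z gap n_eq q_le3 => [|[|y]] [|[|[|[|z]]]]; lia.
Qed.

Lemma r4_eq1 s : (r4 s == 1) = (nfix s + (ntwo s).*2 == n)%N.
Proof.
by rewrite (le1_eq1_of_gap N2_gt0 (r4_gap s)); have := nfix_ntwo_nlong s; lia.
Qed.

(** The numerator is [n (m - 3)] for [p = 0] and [n m] for [p = 1]; for [p >= 2] it is at least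
    [3 q (p - 1)] with [q = 2 t + m], so it vanishes only when no point moves. *)
Lemma r5_eq1 s : odd n ->
  (r5 s == 1) = [|| nfix s == n, (nfix s == 1%N) && ((ntwo s).*2.+1 == n)
                  | (nfix s == 0%N) && ((ntwo s).*2.+3 == n)].
Proof.
move=> n_odd; rewrite (le1_eq1_of_gap N13_gt0 (r5_gap s n_odd)).
have := nfix_ntwo_nlong s; have := nlong_gap s.
move: (nfix s) (ntwo s) (nlong s) => [|[|x]] y z gap n_eq.
- have -> : (y.*2 + z = n)%N by lia.
  rewrite muln0 add0n [(y.*2 * n)%N]mulnC -mulnBr muln_eq0; lia.
- have -> : (3 * 1 + n - 3 = n)%N by lia.
  by rewrite -mulnBl muln_eq0; lia.
- have -> : (3 * x.+2 + n - 3 = n + 3 * x.+1)%N by lia.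
  rewrite mulnDr subn_eq0; have [q0|q_gt0] := posnP (y.*2 + z)%N; first by lia.
  have : (y.*2 * n <= (y.*2 + z) * n)%N by rewrite leq_mul2r leq_addr orbT.
  have : (0 < (y.*2 + z) * (3 * x.+1))%N by rewrite muln_gt0 q_gt0.
  by lia.
Qed.

Lemma r1_le1 s : r1 s <= 1 :> R.
Proof. by rewrite (le1_eq1_of_gap N2_gt0 (r1_gap s)). Qed.

Lemma r2_le1 s : r2 s <= 1 :> R.
Proof.
by have := r2_gap s; rewrite -[_%:R]divr1 => /(le1_eq1_of_gap ltr01) ->.
Qed.

Lemma r3_le1 s : r3 s <= 1 :> R.
Proof. by rewrite (le1_eq1_of_gap N23_gt0 (r3_gap s)). Qed.

Lemma r4_le1 s : r4 s <= 1 :> R.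
Proof. by rewrite (le1_eq1_of_gap N2_gt0 (r4_gap s)). Qed.

Lemma r5_le1 s : odd n -> r5 s <= 1 :> R.
Proof. by move=> n_odd; rewrite (le1_eq1_of_gap N13_gt0 (r5_gap s n_odd)). Qed.

Lemma r1_id : r1 1%g = 1.
Proof. by apply/eqP; rewrite r1_eq1 nfix1 eqxx orbT. Qed.

Lemma r2_id : r2 1%g = 1.
Proof. by apply/eqP; rewrite r2_eq1 ntwo1. Qed.

Lemma r3_id : r3 1%g = 1.
Proof. by apply/eqP; rewrite r3_eq1 nfix1 eqxx. Qed.

Lemma r4_id : r4 1%g = 1.
Proof. by apply/eqP; rewrite r4_eq1 nfix1 ntwo1 addn0. Qed.

Lemma r5_id : r5 1%g = 1.
Proof. by rewrite ffunE nfix1 ntwo1; field; exact: N13_neq0. Qed.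

(** * Coordinates with respect to [r1], [r2], [r4] *)

Lemma scaleE (a x : R) : a *: (x : R^o) = a * x. Proof. by []. Qed.

Lemma r3E : r3 = r4 + (N - 3)^-1 *: (r2 - r1).
Proof.
apply/ffunP => s; rewrite !ffunE scaleE; field.
by rewrite N2_neq0 N3_neq0 N23_neq0.
Qed.

Lemma r5E : r5 = (3 * (N - 2) / ((N - 3) * (N + 1))) *: r1
                 + (- 3 / ((N - 3) * (N + 1))) *: r2 + ((N - 2) / (N + 1)) *: r4.
Proof.
apply/ffunP => s; rewrite !ffunE !scaleE; field.
by rewrite N2_neq0 N3_neq0 N1_neq0 N13_neq0.
Qed.

Lemma spanV_coords g : g \in spanV R n <->
  exists A B C, g = A *: r1 + B *: r2 + C *: r4.
Proof.
pose u1 : funS := [ffun s => p s - 1]; pose u2 : funS := [ffun s => p s ^+ 2 - 2].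
have r1E : r1 = (N - 2)^-1 *: (u2 - N *: u1).
  by apply/ffunP => s; rewrite !ffunE !scaleE; field; exact: N2_neq0.
have r4E : r4 = (N - 2)^-1 *: (u1 - r2).
  by apply/ffunP => s; rewrite !ffunE !scaleE; field; exact: N2_neq0.
rewrite /spanV -/u1 -/u2 -[finfun _ in X in X :: nil]/r2; split.
  rewrite !span_cons span_nil addv0.
  case/memv_addP=> w1 /vlineP[k1 ->{w1}] [w /memv_addP[w2 /vlineP[k2 ->{w2}]]].
  case=> w3 /vlineP[k3 ->{w3}] ->{w} ->.
  (* Substitute [u2 = (N - 2) r1 + N u1], then [u1 = (N - 2) r4 + r2]. *)
  exists ((N - 2) * k2), (k1 + N * k2 + k3), ((N - 2) * (k1 + N * k2)).
  rewrite r1E r4E; apply/ffunP => s; rewrite !ffunE !scaleE; field.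
  exact: N2_neq0.
have [u1_in u2_in r2_in] : [/\ u1 \in <<[:: u1; u2; r2]>>%VS,
    u2 \in <<[:: u1; u2; r2]>>%VS & r2 \in <<[:: u1; u2; r2]>>%VS].
  by split; apply: memv_span; rewrite !inE eqxx ?orbT.
case=> [A [B [C ->]]]; rewrite !memvD ?memvZ // ?r1E ?r4E memvZ ?memvB //.
by rewrite memvZ.
Qed.

Lemma r1_spanV : r1 \in spanV R n.
Proof.
by apply/spanV_coords; exists 1, 0, 0; rewrite scale1r !scale0r !addr0.
Qed.

Lemma r2_spanV : r2 \in spanV R n.
Proof.
by apply/spanV_coords; exists 0, 1, 0; rewrite scale1r !scale0r add0r addr0.
Qed.

Lemma r4_spanV : r4 \in spanV R n.
Proof.
by apply/spanV_coords; exists 0, 0, 1; rewrite scale1r !scale0r !add0r.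
Qed.

Lemma r3_spanV : r3 \in spanV R n.
Proof.
by rewrite r3E memvD ?memvZ ?memvB ?r1_spanV ?r2_spanV ?r4_spanV.
Qed.

Lemma r5_spanV : r5 \in spanV R n.
Proof.
by rewrite r5E !memvD ?memvZ ?r1_spanV ?r2_spanV ?r4_spanV.
Qed.

(** * Facet inequalities in these coordinates *)

Lemma coneK_gap A B C s : coneK (A *: r1 + B *: r2 + C *: r4) ->
  0 <= A * (p s * (2 * t s + m s)) + 2 * (N - 2) * B * t s + C * m s.
Proof.
set g := _ + _ => -[_ /(_ s)].
have gE s' : g s' = A * r1 s' + B * r2 s' + C * r4 s' :> R.
  by rewrite /g; move: r1 r2 r4 => f1 f2 f4; rewrite !ffunE.
rewrite !gE r1_id r2_id r4_id -subr_ge0.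
have -> : A * 1 + B * 1 + C * 1 - (A * r1 s + B * r2 s + C * r4 s)
    = A * (1 - r1 s) + B * (1 - r2 s) + C * (1 - r4 s) by ring.
rewrite r1_gap r2_gap r4_gap.
rewrite natrM natrD -muln2 natrM -(pmulr_rge0 _ N2_gt0).
by congr (0 <= _); field; exact: N2_neq0.
Qed.

(** The gap is [N C] at the [n]-cycle, [3 (A (N - 3) + C)] at the 3-cycle and [2 (N - 2) (A + B)] at
    the transposition. *)
Lemma coneK_facets A B C : coneK (A *: r1 + B *: r2 + C *: r4) ->
  [/\ 0 <= C, 0 <= A * (N - 3) + C & 0 <= A + B].
Proof.
move=> /coneK_gap gap; have N_cyc s := nfix_ntwo_nlong s; split.
- have [|s [ps ts]] := @exists_long_cycle n; first by lia.
  have ms : nlong s = n by have := N_cyc s; lia.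
  by move: (gap s) N_ge4; rewrite ps ts ms; nra.
- have [|s [ps ts]] := @exists_three_cycle n; first by lia.
  have ms : nlong s = 3%N by have := N_cyc s; lia.
  have pE : p s = N - 3 by rewrite -{2}ps natrD; ring.
  by move: (gap s); rewrite pE ts ms; lra.
- have [|s [ps ts]] := @exists_transposition n; first by lia.
  have ms : nlong s = 0%N by have := N_cyc s; lia.
  have pE : p s = N - 2 by rewrite -{2}ps natrD; ring.
  by move: (gap s) N_ge4; rewrite pE ts ms; nra.
Qed.

(** For even [n] the reversal has [p = m = 0], so only the term in [B] survives. *)
Lemma coneK_facet_even A B C : ~~ odd n ->
  coneK (A *: r1 + B *: r2 + C *: r4) -> 0 <= B.
Proof.
move=> n_even /coneK_gap gap; have [s [ps pts]] := @exists_reversal n.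
rewrite (negPf n_even) /= in ps.
have [p0 ms tE] : [/\ nfix s = 0%N, nlong s = 0%N & (ntwo s).*2 = n].
  by split; have := nfix_ntwo_nlong s; lia.
have t_gt0 : 0 < t s by rewrite ltr0n; lia.
move: (gap s); rewrite p0 ms !mul0r !mulr0 add0r addr0.
by rewrite -mulrA pmulr_rge0 ?mulr_gt0 ?N2_gt0 // pmulr_lge0.
Qed.

(** The reversal now has [p = 1] and [m = 0], giving [2 t (A + B (N - 2))]; the derangement has
    [p = 0], [m = 3] and [2 t = N - 3]. *)
Lemma coneK_facets_odd A B C : odd n ->
  coneK (A *: r1 + B *: r2 + C *: r4) ->
  0 <= A + B * (N - 2) /\ 0 <= B * (N - 2) * (N - 3) + 3 * C.
Proof.
move=> n_odd /coneK_gap gap; split.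
- have [s [ps pts]] := @exists_reversal n; rewrite n_odd /= in ps.
  have [p1 ms] : nfix s = 1%N /\ nlong s = 0%N.
    by have := nfix_ntwo_nlong s; lia.
  have t_gt0 : 0 < 2 * t s by rewrite mulr_gt0 // ltr0n; lia.
  rewrite -(pmulr_rge0 _ t_gt0).
  by move: (gap s); rewrite p1 ms; congr (0 <= _); ring.
- have [|s [p0 tE]] := exists_odd_derangement _ n_odd; first by lia.
  have ms : nlong s = 3%N by have := nfix_ntwo_nlong s; lia.
  have tE' : 2 * t s = N - 3.
    by rewrite -[N](congr1 (fun k => k%:R) tE) natrD -muln2 natrM; ring.
  move: (gap s); rewrite p0 ms mul0r mulr0 add0r.
  rewrite (_ : 2 * (N - 2) * B * t s = B * (N - 2) * (2 * t s)); last by ring.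
  by rewrite tE' [C * _]mulrC.
Qed.

(** * From nonnegative combinations to a planar base *)

Lemma base_of_generators (s : seq funS) :
    polygon_vertices s ->
    (forall r, r \in s ->
       [/\ r \in spanV R n, r 1%g = 1 & forall x, r x <= 1 :> R]) ->
    (forall g, coneK g -> exists2 a : nat -> R,
       forall i, 0 <= a i & g = \sum_(i < size s) a i *: s`_i) ->
  is_base_of_K (conv_hull s).
Proof.
move=> polygon_s s_in gen.
have s_nth (i : 'I_(size s)) := s_in s`_i (mem_nth 0 (ltn_ord i)).
have sumE (a : 'I_(size s) -> R) x :
    (\sum_i a i *: s`_i) x = \sum_i a i * s`_i x :> R.
  by rewrite sum_ffunE; apply: eq_bigr => i _; rewrite ffunE.
(* All generators take the value 1 at the identity, so the weights of a combination sum to its value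
   there; this value is the only possible scale. *)
have sum1E (a : 'I_(size s) -> R) : (\sum_i a i *: s`_i) 1%g = \sum_i a i :> R.
  rewrite sumE; apply: eq_bigr => i _.
  by have [_ -> _] := s_nth i; rewrite mulr1.
have scale_conv (a : 'I_(size s) -> R) (l : R) :
    (forall i, 0 <= a i) -> 0 < l -> \sum_i a i = l ->
    conv_hull s (l^-1 *: \sum_i a i *: s`_i).
  move=> a_ge0 l_gt0 al; exists (fun i => l^-1 * a i); split.
  - by move=> i; rewrite mulr_ge0 // invr_ge0 ltW.
  - by rewrite -mulr_sumr al mulVf // gt_eqF.
  - by rewrite scaler_sumr; apply: eq_bigr => i _; rewrite scalerA.
have baseE : conv_hull s = @coneK R n `&` @planeH R n.
  apply/seteqP; split => [_ [a [a_ge0 a1 ->]]|g [/gen[a a_ge0 ->]]].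
    have e1 : (\sum_i a i *: s`_i) 1%g = 1 :> R by rewrite sum1E.
    split=> //; split=> [|x].
      by apply: memv_suml => i _; rewrite memvZ //; have [] := s_nth i.
    rewrite e1 sumE -[leRHS]a1; apply: ler_sum => i _.
    have [_ _ /(_ x) si] := s_nth i.
    by rewrite -[leRHS]mulr1; apply: ler_wpM2l.
  rewrite /planeH /= sum1E => a1.
  have := scale_conv (fun i => a i) 1 _ ltr01 a1.
  by rewrite invr1 scale1r; apply.
split=> //; first by exists s.
move=> g Kg g_neq0; have [a a_ge0 gE] := gen g Kg.
pose l := \sum_(i < size s) a i.
(* Nonnegative weights with sum 0 all vanish, which would make [g] zero. *)
have l_gt0 : 0 < l.
  rewrite lt_def sumr_ge0 // andbT; apply: contraNneq g_neq0 => /eqP.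
  rewrite psumr_eq0 // => /allP a0; rewrite gE big1 // => i _.
  by have /eqP -> := a0 i (mem_index_enum i); rewrite scale0r.
exists (l, l^-1 *: g); split.
  split=> //; first by rewrite /= gE; apply: scale_conv.
  by rewrite /= scalerA mulfV ?scale1r // gt_eqF.
move=> [l' h] [/= l'_gt0]; rewrite baseE => -[_ h1] gE'.
have l'E : l' = l.
  have := sum1E (fun i => a i); rewrite -gE gE' ffunE -/l => <-.
  by rewrite h1 [RHS]mulr1.
by congr pair; rewrite // gE' l'E scalerA mulVf ?scale1r // gt_eqF.
Qed.

Lemma affine_dim_generators (s : seq funS) :
    head 0 s = r1 -> r2 \in s -> r4 \in s ->
    {subset s <= [:: r1; r2; r3; r4; r5]} ->
  affine_dim s = 2%N.
Proof.
move=> s_head r2s r4s s_sub; rewrite /affine_dim s_head.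
pose W := <<[:: r2 - r1; r4 - r1]>>%VS.
have [W2 W4] : r2 - r1 \in W /\ r4 - r1 \in W.
  by split; apply: memv_span; rewrite !inE eqxx ?orbT.
have -> : <<[seq x - r1 | x <- s]>>%VS = W.
  apply/eqP; rewrite eqEsubv; apply/andP; split; apply/span_subvP => v.
    case/mapP => x /s_sub xs ->{v}; move: xs; rewrite !inE.
    case/or4P => [/eqP ->|/eqP ->|/eqP ->|/orP[] /eqP ->] //.
    - by rewrite subrr mem0v.
    - by rewrite r3E addrAC memvD // memvZ.
    - rewrite r5E.
      (* The three coefficients in [r5E] sum to 1, so [r1] can be absorbed into differences. *)
      rewrite (_ : _ - r1 = (- 3 / ((N - 3) * (N + 1))) *: (r2 - r1)
                            + ((N - 2) / (N + 1)) *: (r4 - r1)).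
        by rewrite memvD ?memvZ.
      move: (r1) (r2) (r4) => f1 f2 f4; apply/ffunP => y.
      rewrite !ffunE !scaleE; field.
      by rewrite N3_neq0 N1_neq0.
  by rewrite !inE => /orP[] /eqP ->; apply/memv_span/map_f.
(* Independence: at the [n]-cycle [r2 - r1] vanishes while [r4 - r1] does not, and at the 3-cycle
   [r2 - r1] is nonzero. *)
have [|s1 [p1 t1]] := @exists_long_cycle n; first by lia.
have [|s2 [p2 t2]] := @exists_three_cycle n; first by lia.
have r1s1 : r1 s1 = 1 by apply/eqP; rewrite r1_eq1 p1.
have r2s1 : r2 s1 = 1 by apply/eqP; rewrite r2_eq1 t1.
have r4s1 : r4 s1 != 1 by rewrite r4_eq1 p1 t1; lia.
have r2s2 : r2 s2 = 1 by apply/eqP; rewrite r2_eq1 t2.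
have r1s2 : r1 s2 != 1 by rewrite r1_eq1; lia.
suff : free [:: r2 - r1; r4 - r1] by rewrite /free => /eqP.
move: r1s1 r2s1 r4s1 r2s2 r1s2; move: (r1) (r2) (r4) => f1 f2 f4.
move=> f1s1 f2s1 f4s1 f2s2 f1s2; rewrite free_cons seq1_free span_seq1.
apply/andP; split; last first.
  by apply: contraNneq f4s1 => /eqP; rewrite subr_eq0 => /eqP ->; rewrite f1s1.
apply: contraNN f1s2 => /vlineP[k fE].
have k0 : k = 0.
  move/ffunP: fE => /(_ s1); rewrite !ffunE f1s1 f2s1 subrr => /esym/eqP.
  by rewrite mulf_eq0 subr_eq0 (negPf f4s1) orbF => /eqP.
move: fE; rewrite k0 scale0r => /eqP; rewrite subr_eq0 => /eqP <-.
by rewrite f2s2.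
Qed.

(** * Nonnegative generation of the cone *)

Lemma nth_ge0 (l : seq R) (i : nat) : all (fun x => 0 <= x) l -> 0 <= l`_i.
Proof.
move=> /all_nthP l_ge0.
by case: (ltnP i (size l)) => [/l_ge0|/(nth_default 0) ->].
Qed.

Lemma coneK_generated_even g : ~~ odd n -> coneK g ->
  exists2 a : nat -> R, forall i, 0 <= a i &
    g = \sum_(i < 4) a i *: [:: r1; r2; r3; r4]`_i.
Proof.
move=> n_even Kg; have [A [B [C gE]]] := (spanV_coords g).1 Kg.1.
rewrite gE in Kg *; have [C_ge0 AC_ge0 AB_ge0] := coneK_facets Kg.
have B_ge0 := coneK_facet_even n_even Kg.
have [A_ge0|A_lt0] := lerP 0 A.
  exists (nth 0 [:: A; B; 0; C]).
    by move=> i; apply: nth_ge0; rewrite /= lexx A_ge0 B_ge0 C_ge0.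
  by rewrite !big_ord_recr big_ord0 /= add0r scale0r addr0.
(* Substitute [r1 = r2 - (N - 3) (r3 - r4)]; the weights of [r2] and [r4] are facet inequalities. *)
exists (nth 0 [:: 0; A + B; - A * (N - 3); C + A * (N - 3)]).
  move=> i; apply: nth_ge0; rewrite /= lexx AB_ge0 [C + _]addrC AC_ge0 !andbT /=.
  by move: N_ge4; nra.
rewrite !big_ord_recr big_ord0 /= r3E.
move: (r1) (r2) (r4) => f1 f2 f4; apply/ffunP => s.
by rewrite !ffunE !scaleE; field; exact: N3_neq0.
Qed.

Lemma coneK_generated_odd g : odd n -> coneK g ->
  exists2 a : nat -> R, forall i, 0 <= a i &
    g = \sum_(i < 5) a i *: [:: r1; r2; r3; r4; r5]`_i.
Proof.
move=> n_odd Kg; have [A [B [C gE]]] := (spanV_coords g).1 Kg.1.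
rewrite gE in Kg *; have [C_ge0 AC_ge0 AB_ge0] := coneK_facets Kg.
have [AB'_ge0 BC_ge0] := coneK_facets_odd n_odd Kg.
have [A_lt0|A_ge0] := ltrP A 0.
  exists (nth 0 [:: 0; A + B; - A * (N - 3); C + A * (N - 3); 0]).
    move=> i; apply: nth_ge0; rewrite /= lexx AB_ge0 [C + _]addrC AC_ge0 !andbT /=.
    by move: N_ge4; nra.
  rewrite !big_ord_recr big_ord0 /= r3E.
  move: (r1) (r2) (r4) (r5) => f1 f2 f4 f5; apply/ffunP => s.
  by rewrite !ffunE !scaleE; field; exact: N3_neq0.
have [B_ge0|B_lt0] := lerP 0 B.
  exists (nth 0 [:: A; B; 0; C; 0]).
    by move=> i; apply: nth_ge0; rewrite /= lexx A_ge0 B_ge0 C_ge0.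
  by rewrite !big_ord_recr big_ord0 /= add0r !scale0r !addr0.
(* [r2] is eliminated through [r5E], where its coefficient is [- 3 / ((N - 3) (N + 1))]; up to
   positive factors, the weights of [r1] and [r4] are the facet inequalities for odd [n]. *)
exists (nth 0 [:: A + B * (N - 2); 0; 0; C + B * (N - 2) * (N - 3) / 3;
               - B * (N - 3) * (N + 1) / 3]).
  move=> i; apply: nth_ge0; rewrite /= lexx AB'_ge0 /= andbT; apply/andP; split.
    by move: BC_ge0; lra.
  have N31_ge0 : 0 <= (N - 3) * (N + 1) by rewrite mulr_ge0; move: N_ge4; lra.
  by rewrite divr_ge0 // -mulrA mulr_ge0 // oppr_ge0 ltW.
rewrite !big_ord_recr big_ord0 /= r5E.
move: (r1) (r2) (r3) (r4) => f1 f2 f3 f4; apply/ffunP => s.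
by rewrite !ffunE !scaleE; field; rewrite N3_neq0 N1_neq0.
Qed.

Lemma generator_in_coneK r : r \in [:: r1; r2; r3; r4] \/ odd n /\ r = r5 ->
  [/\ r \in spanV R n, r 1%g = 1 & forall s, r s <= 1 :> R].
Proof.
case=> [|[n_odd ->]]; last first.
  by split; [exact: r5_spanV | exact: r5_id | move=> s; exact: r5_le1].
rewrite !inE => /or4P[] /eqP ->.
- by split; [exact: r1_spanV | exact: r1_id | exact: r1_le1].
- by split; [exact: r2_spanV | exact: r2_id | exact: r2_le1].
- by split; [exact: r3_spanV | exact: r3_id | exact: r3_le1].
- by split; [exact: r4_spanV | exact: r4_id | exact: r4_le1].
Qed.

(** * Vertices and edges of the two polygons *)

Lemma polygon_even : ~~ odd n -> polygon_vertices [:: r1; r2; r3; r4].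
Proof.
move=> n_even.
have [|s0 [p0 t0]] := @exists_long_cycle n; first by lia.
have [|s1 [p1 t1]] := @exists_three_cycle n; first by lia.
have [|s2 [p2 t2]] := @exists_transposition n; first by lia.
have [s3 []] := @exists_reversal n; rewrite (negPf n_even) /= => p3 t3.
(* [s0] to [s3] support the edges [r1 r2], [r2 r3], [r3 r4], [r4 r1], in this order. *)
apply: (@polygon_vertices_supp R funS _
  (fun i => @eval_at R n (nth s0 [:: s0; s1; s2; s3] i)) 1) => //.
- apply: affine_dim_generators => //; rewrite ?inE ?eqxx ?orbT // => x.
  by rewrite !inE => /or4P[] ->; rewrite ?orbT.
- move=> i j _ j_lt; rewrite /= /eval_at.
  have [|_ _ ->] // := @generator_in_coneK [:: r1; r2; r3; r4]`_j.
  by left; apply: mem_nth.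
- move=> i j i_lt j_lt; rewrite /= /eval_at.
  by move: i j i_lt j_lt => [|[|[|[|i]]]] [|[|[|[|j]]]] // _ _ /=;
    rewrite ?r1_eq1 ?r2_eq1 ?r3_eq1 ?r4_eq1; lia.
Qed.

Lemma polygon_odd : odd n -> polygon_vertices [:: r1; r2; r3; r4; r5].
Proof.
move=> n_odd.
have [|s0 [p0 t0]] := @exists_long_cycle n; first by lia.
have [|s1 [p1 t1]] := @exists_three_cycle n; first by lia.
have [|s2 [p2 t2]] := @exists_transposition n; first by lia.
have [s3 []] := @exists_reversal n; rewrite n_odd /= => p3 t3.
have [|s4 [p4 t4]] := exists_odd_derangement _ n_odd; first by lia.
(* The reversal, now with a fixed point, supports [r4 r5o], and the derangement [s4] closes the
   pentagon along [r5o r1]. *)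
apply: (@polygon_vertices_supp R funS _
  (fun i => @eval_at R n (nth s0 [:: s0; s1; s2; s3; s4] i)) 1) => //.
- by apply: affine_dim_generators => //; rewrite !inE eqxx ?orbT.
- move=> i j _ j_lt; rewrite /= /eval_at.
  have [|_ _ ->] // := @generator_in_coneK [:: r1; r2; r3; r4; r5]`_j.
  have := mem_nth 0 j_lt; rewrite (mem_cat _ [:: r1; r2; r3; r4] [:: r5]).
  by case/orP; [left | rewrite inE => /eqP; right].
- move=> i j i_lt j_lt; rewrite /= /eval_at.
  by move: i j i_lt j_lt => [|[|[|[|[|i]]]]] [|[|[|[|[|j]]]]] // _ _ /=;
    rewrite ?r1_eq1 ?r2_eq1 ?r3_eq1 ?r4_eq1 ?r5_eq1 //; lia.
Qed.

End Cone.

Theorem proposition11p2 (R : realType) (n : nat) (hn : (4 <= n)%N) :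
  [/\ [/\ r1 R n 1%g = 1, r2 R n 1%g = 1, r3 R n 1%g = 1, r4 R n 1%g = 1
        & r5o R n 1%g = 1],
      ~~ odd n ->
        polygon_vertices [:: r1 R n; r2 R n; r3 R n; r4 R n] /\
        is_base_of_K (conv_hull [:: r1 R n; r2 R n; r3 R n; r4 R n])
    & odd n ->
        polygon_vertices [:: r1 R n; r2 R n; r3 R n; r4 R n; r5o R n] /\
        is_base_of_K (conv_hull [:: r1 R n; r2 R n; r3 R n; r4 R n; r5o R n])].
Proof.
split.
- by rewrite r1_id ?r2_id ?r3_id ?r4_id ?r5_id.
- move=> n_even; have poly := polygon_even R hn n_even; split=> //.
  apply: base_of_generators => // [r r_in|g Kg].
    by apply: generator_in_coneK => //; left.
  exact: coneK_generated_even.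
- move=> n_odd; have poly := polygon_odd R hn n_odd; split=> //.
  apply: base_of_generators => // [r r_in|g Kg].
    apply: generator_in_coneK => //; move: r_in.
    rewrite (mem_cat _ [:: _; _; _; _] [:: _]).
    by case/orP; [left | rewrite inE => /eqP; right].
  exact: coneK_generated_odd.
Qed.
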